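(* Let $A$ be a left-symmetric algebra which is embeddable into $\Psi(V)$ for a vertex algebra $V$ (that is, there is an injective homomorphism of left-symmetric algebras $A\to\Psi(V)$, by means of which $A$ is identified with a subalgebra of $\Psi(V)$), and suppose that there exists $N\in\mathbb Z_+$ such that $N_V(a,b)\le N$ for all $a,b\in A$. Then $A$ is Lie-nilpotent, i.e., the commutator Lie algebra $A^{(-)}$ is nilpotent.
   Context: All linear spaces are over a field $\Bbbk$ of characteristic zero; $\mathbb Z_+$ is the set of non-negative integers. A left-symmetric algebra is a linear space with a bilinear product $x.y$ such that $(x.y).z-x.(y.z)=(y.x).z-y.(x.z)$. For a left-symmetric algebra $A$, $A^{(-)}$ is the Lie algebra on the space $A$ with bracket $[a,b]=a.b-b.a$. A Lie conformal algebra is a linear space $L$ with a linear operator $T$ and bilinear $n$-products $(\cdot{}_{(n)}\cdot)$, $n\in\mathbb Z_+$, such that for all $x,y\in L$ the $\lambda$-bracket $(x{}_{(\lambda)}y)=\sum_{n\ge0}\frac{\lambda^n}{n!}(x{}_{(n)}y)$ is a polynomial in $L[\lambda]$, and: $(Tx{}_{(\lambda)}y)=-\lambda(x{}_{(\lambda)}y)$, $(x{}_{(\lambda)}Ty)=(T+\lambda)(x{}_{(\lambda)}y)$; $(x{}_{(\lambda)}y)+(y{}_{(-T-\lambda)}x)=0$; $(x{}_{(\lambda)}(y{}_{(\mu)}z))-(y{}_{(\mu)}(x{}_{(\lambda)}z))=((x{}_{(\lambda)}y){}_{(\lambda+\mu)}z)$. The locality function $N_L(x,y)$ is the smallest $N\in\mathbb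 Z_+$ with $(x{}_{(n)}y)=0$ for all $n\ge N$. A vertex algebra is a linear space $V$ with a linear operator $T$, a bilinear product $x.y$ and a $\lambda$-bracket such that: (V1) $(V,.)$ is a unital left-symmetric algebra and $T$ is a derivation of it; (V2) $V$ with $T$ and the $\lambda$-bracket is a Lie conformal algebra; (V3) for all $x,y,z\in V$: $x.y-y.x=\int_{-T}^0(x{}_{(\lambda)}y)\,d\lambda$ (that is, $\sum_{n\ge0}(-1)^n\frac{T^{n+1}}{(n+1)!}(x{}_{(n)}y)$), and $(x{}_{(\lambda)}y.z)=(x{}_{(\lambda)}y).z+y.(x{}_{(\lambda)}z)+\int_0^\lambda((x{}_{(\lambda)}y){}_{(\mu)}z)\,d\mu$. $\Psi$ is the forgetful functor from vertex algebras to left-symmetric algebras, sending $V$ to $(V,.)$ (ignoring the $\lambda$-bracket). *)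

(* Defs.v *)
From HB Require Import structures.
From mathcomp Require Import all_boot all_order all_algebra.
From mathcomp Require Import sesquilinear.
From mathcomp Require Import boolp classical_sets fsbigop.

Set Implicit Arguments.
Unset Strict Implicit.
Unset Printing Implicit Defensive.

Import GRing.Theory.
Local Open Scope ring_scope.
Local Open Scope classical_set_scope.

Record lieAlgebra (K : fieldType) := LieAlgebra {
  lie_sort :> lmodType K;
  lie_br : {bilinear lie_sort -> lie_sort -> lie_sort};
  lie_alternating : forall x, lie_br x x = 0;
  lie_jacobi : forall x y z,
    lie_br x (lie_br y z) + lie_br y (lie_br z x) + lie_br z (lie_br x y) = 0
}.

Definition lin_span (K : fieldType) (L : lmodType K) (S : set L) : set L :=
  [set x | exists (n : nat) (a : 'I_n -> K) (s : 'I_n -> L),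
     (forall i, S (s i)) /\ x = \sum_(i < n) a i *: s i].

Section LowerCentral.
Variables (K : fieldType) (L : lieAlgebra K).

(* [lower_central 0] is the whole of L, so that [lower_central n] is the term
   usually written L^(n+1). *)
Fixpoint lower_central (n : nat) : set L :=
  if n is m.+1 then
    lin_span [set z | exists x y, lower_central m y /\ z = lie_br L x y]
  else setT.

Definition lie_nilpotent : Prop := exists n, lower_central n = [set 0].

End LowerCentral.

Arguments lower_central {K} L n.

Definition left_symmetric (K : fieldType) (A : lmodType K)
    (mul : A -> A -> A) : Prop :=
  forall x y z, mul (mul x y) z - mul x (mul y z)
              = mul (mul y x) z - mul y (mul x z).

Record leftSymAlgebra (K : fieldType) := LeftSymAlgebra {
  lsa_sort :> lmodType K;
  lsa_mul : {bilinear lsa_sort -> lsa_sort -> lsa_sort};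
  lsa_axiom : left_symmetric lsa_mul
}.

Definition lsa_morphism (K : fieldType) (A B : leftSymAlgebra K)
    (f : {linear A -> B}) : Prop :=
  forall a b, f (lsa_mul A a b) = lsa_mul B (f a) (f b).

Section Commutator.
Variables (K : fieldType) (A : leftSymAlgebra K).

Definition lsa_commutator (a b : A) : A := lsa_mul A a b - lsa_mul A b a.

Fact lsa_commutator_bilinear : bilinear_for *:%R *:%R lsa_commutator.
Proof.
by split=> x a u v; rewrite /lsa_commutator linearPl linearPr /= scalerBr opprD
  addrACA.
Qed.

HB.instance Definition _ := bilinear_isBilinear.Build K A A A *:%R *:%R
  lsa_commutator lsa_commutator_bilinear.

Fact lsa_commutator_alternating (x : A) : lsa_commutator x x = 0.
Proof. exact: subrr. Qed.

Fact lsa_commutator_jacobi (x y z : A) :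
  lsa_commutator x (lsa_commutator y z) + lsa_commutator y (lsa_commutator z x)
  + lsa_commutator z (lsa_commutator x y) = 0.
Proof.
have cyc (u v w : A) : lsa_mul A u (lsa_mul A v w) - lsa_mul A v (lsa_mul A u w)
    - lsa_mul A (lsa_mul A u v) w + lsa_mul A (lsa_mul A v u) w = 0.
  have /eqP := lsa_axiom u v w; rewrite -subr_eq0 => /eqP E.
  by rewrite -[RHS]oppr0 -E !opprD !opprK !addrA [RHS](ACl (2*4*1*3))%AC.
have E (u v w : A) : lsa_commutator u (lsa_commutator v w)
  = lsa_mul A u (lsa_mul A v w) + - lsa_mul A u (lsa_mul A w v)
    + - lsa_mul A (lsa_mul A v w) u + lsa_mul A (lsa_mul A w v) u.
  by rewrite /lsa_commutator linearBl linearBr opprB addrA (ACl (1*2*4*3))%AC.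
rewrite !E !addrA (ACl ((1*6*11*12)*(5*10*3*4)*(9*2*7*8)))%AC /=.
by rewrite !cyc !addr0.
Qed.

(* The Lie algebra A^(-). *)
Definition lsa_lie : lieAlgebra K :=
  @LieAlgebra K A lsa_commutator
    lsa_commutator_alternating lsa_commutator_jacobi.

End Commutator.

(* A polynomial over a space L in one variable lambda (resp. two variables
   lambda, mu) is represented by its coefficients nat -> L (resp.
   nat -> nat -> L), and identities in L[lambda] and L[lambda, mu] are stated
   coefficientwise. *)

(* multiplication by lambda *)
Definition lmul (K : fieldType) (L : lmodType K) (p : nat -> L) (n : nat) : L :=
  if n is m.+1 then p m else 0.

(* The substitution p(lambda) |-> p(-T-lambda), T acting on coefficients:
   (-T-lambda)^n = \sum_m (-1)^n 'C(n, m) T^(n-m) lambda^m.  The sum over n is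
   the sum of a finitely supported family as soon as p is a polynomial. *)
Definition lsubst_opp (K : fieldType) (L : lmodType K) (T : L -> L)
    (p : nat -> L) (m : nat) : L :=
  \sum_(n \in [set: nat]) ((-1) ^+ n * 'C(n, m)%:R : K) *: iter (n - m) T (p n).

(* The lambda-bracket (x_(lambda) y) = \sum_n lambda^n / n! (x_(n) y). *)
Definition lbracket (K : fieldType) (L : lmodType K) (nprod : nat -> L -> L -> L)
    (x y : L) (n : nat) : L :=
  (n`!%:R : K)^-1 *: nprod n x y.

(* ((x_(lambda) y)_(lambda+mu) z): the bracket with z is extended to L[lambda]
   linearly over K[lambda], and (lambda + mu)^n is expanded. *)
Definition lbracket_add (K : fieldType) (L : lmodType K)
    (nprod : nat -> L -> L -> L) (x y z : L) (p q : nat) : L :=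
  \sum_(i < p.+1)
    lbracket nprod (lbracket nprod x y i) z (p - i + q) *+ 'C(p - i + q, q).

(* \int_0^lambda ((x_(lambda) y)_(mu) z) dmu, from
   \int_0^lambda lambda^i mu^j dmu = lambda^(i+j+1) / (j+1). *)
Definition lbracket_int (K : fieldType) (L : lmodType K)
    (nprod : nat -> L -> L -> L) (x y z : L) (n : nat) : L :=
  \sum_(j < n)
    (j.+1%:R : K)^-1 *: lbracket nprod (lbracket nprod x y (n - j.+1)) z j.

Record lieConformalAlgebra (K : fieldType) := LieConformalAlgebra {
  lca_sort :> lmodType K;
  lca_T : {linear lca_sort -> lca_sort};
  lca_nprod : nat -> {bilinear lca_sort -> lca_sort -> lca_sort};
  lca_poly : forall x y,
    exists N, forall n, (N <= n)%N -> lca_nprod n x y = 0;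
  lca_Tl : forall x y n,
    lbracket lca_nprod (lca_T x) y n = - lmul (lbracket lca_nprod x y) n;
  lca_Tr : forall x y n,
    lbracket lca_nprod x (lca_T y) n
    = lca_T (lbracket lca_nprod x y n) + lmul (lbracket lca_nprod x y) n;
  lca_skew : forall x y n,
    lbracket lca_nprod x y n + lsubst_opp lca_T (lbracket lca_nprod y x) n = 0;
  (* coefficient of lambda^p mu^q *)
  lca_jacobi : forall x y z p q,
    lbracket lca_nprod x (lbracket lca_nprod y z q) p
    - lbracket lca_nprod y (lbracket lca_nprod x z p) q
    = lbracket_add lca_nprod x y z p q
}.

Section Locality.
Variables (K : fieldType) (L : lieConformalAlgebra K).

Definition is_locality_bound (x y : L) (N : nat) : bool :=
  `[< forall n, (N <= n)%N -> lca_nprod L n x y = 0 >].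

Fact locality_bound_ex (x y : L) : exists N, is_locality_bound x y N.
Proof. by have [N NP] := lca_poly x y; exists N; apply/asboolP. Qed.

Definition locality (x y : L) : nat := ex_minn (locality_bound_ex x y).

End Locality.

Record vertexAlgebra (K : fieldType) := VertexAlgebra {
  va_lca :> lieConformalAlgebra K;
  va_mul : {bilinear va_lca -> va_lca -> va_lca};
  va_one : va_lca;
  va_mul1l : forall x, va_mul va_one x = x;
  va_mul1r : forall x, va_mul x va_one = x;
  va_lsym : left_symmetric va_mul;
  va_derivation : forall x y,
    lca_T va_lca (va_mul x y)
    = va_mul (lca_T va_lca x) y + va_mul x (lca_T va_lca y);
  va_comm : forall x y,
    va_mul x y - va_mul y x
    = \sum_(n \in [set: nat])
        ((-1) ^+ n / n.+1`!%:R : K) *: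
          iter n.+1 (lca_T va_lca) (lca_nprod va_lca n x y);
  (* the non-commutative Wick formula *)
  va_wick : forall x y z n,
    lbracket (lca_nprod va_lca) x (va_mul y z) n
    = va_mul (lbracket (lca_nprod va_lca) x y n) z
      + va_mul y (lbracket (lca_nprod va_lca) x z n)
      + lbracket_int (lca_nprod va_lca) x y z n
}.

Definition Psi (K : fieldType) (V : vertexAlgebra K) : leftSymAlgebra K :=
  LeftSymAlgebra (@va_lsym K V).

(* Main.v *)
Require Import Defs.
From mathcomp Require Import all_boot all_order all_algebra.
From mathcomp Require Import boolp classical_sets fsbigop.

Set Implicit Arguments.
Unset Strict Implicit.
Unset Printing Implicit Defensive.

Import GRing.Theory.
Local Open Scope ring_scope.

(** The k-th term L^(k+1) of the lower central series of A^(-) lies in T^k V: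
if u = T^k w, then (u_(lambda) c) = (-lambda)^k (w_(lambda) c), so u_(n) c = 0
for n < k, and the formula for u.c - c.u only involves T^(n+1) with n >= k.
When k >= N, an element u of A lying in T^k V has u_(n) c = 0 for n < k by the
above and for n >= N by locality, for all c in A; hence u is central. *)

Section IteratedImage.
Variables (K : fieldType) (V : lmodType K) (T : {linear V -> V}).

Lemma iter_linearP k a (x y : V) :
  iter k T (a *: x + y) = a *: iter k T x + iter k T y.
Proof. by elim: k => //= k ->; rewrite linearP. Qed.

Lemma iter_linear0 k : iter k T 0 = 0.
Proof. by elim: k => //= k ->; rewrite linear0. Qed.

Definition iter_image k (x : V) : Prop := exists w, x = iter k T w.

Lemma iter_image0 k : iter_image k 0.
Proof. by exists 0; rewrite iter_linear0. Qed.

Lemma iter_imageP k a x y :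
  iter_image k x -> iter_image k y -> iter_image k (a *: x + y).
Proof. by move=> [v ->] [w ->]; exists (a *: v + w); rewrite iter_linearP. Qed.

Lemma iter_imageD k x y :
  iter_image k x -> iter_image k y -> iter_image k (x + y).
Proof. by move=> xk; rewrite -[x]scale1r; apply: iter_imageP. Qed.

Lemma iter_imageZ k a x : iter_image k x -> iter_image k (a *: x).
Proof. by move=> xk; rewrite -[_ *: _]addr0; apply/iter_imageP/iter_image0. Qed.

Lemma iter_image_leq k n x : (k <= n)%N -> iter_image k (iter n T x).
Proof. by move=> kn; exists (iter (n - k) T x); rewrite -iterD subnKC. Qed.

End IteratedImage.

(** Each [lca_T] on the left shifts the coefficients up by one, with a sign, and [lmul] puts 0 in
    degree 0. *)
Lemma lbracket_iterT_eq0 (K : fieldType) (L : lieConformalAlgebra K)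
    (k n : nat) (x y : L) :
  (n < k)%N -> lbracket (lca_nprod L) (iter k (lca_T L) x) y n = 0.
Proof.
elim: k n => // k IHk [|n] nk; rewrite iterS lca_Tl /= ?oppr0 //.
by rewrite IHk ?oppr0.
Qed.

Lemma natf_fact_neq0 (K : fieldType) (n : nat) :
  [pchar K] =i pred0 -> n`!%:R != 0 :> K.
Proof. by move=> /pcharf0P->; rewrite -lt0n fact_gt0. Qed.

(** Characteristic zero makes n! invertible, so a vanishing coefficient of the bracket forces the
    n-product itself to vanish. *)
Lemma nprod_iterT_eq0 (K : fieldType) (charK0 : [pchar K] =i pred0)
    (L : lieConformalAlgebra K) (k n : nat) (x y : L) :
  (n < k)%N -> lca_nprod L n (iter k (lca_T L) x) y = 0.
Proof.
move=> /(lbracket_iterT_eq0 x y)/eqP; rewrite scaler_eq0 invr_eq0.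
by rewrite (negPf (natf_fact_neq0 n charK0)) => /eqP.
Qed.

Lemma nprod_locality_eq0 (K : fieldType) (L : lieConformalAlgebra K)
    (x y : L) (n : nat) :
  (locality x y <= n)%N -> lca_nprod L n x y = 0.
Proof. by rewrite /locality; case: ex_minnP => N /asboolP xyN _; apply: xyN. Qed.

Section Commutators.
Variables (K : fieldType) (charK0 : [pchar K] =i pred0) (V : vertexAlgebra K).
Local Notation T := (lca_T V).

Lemma iter_image_commutator k (x y : V) :
  iter_image T k x -> iter_image T k.+1 (va_mul V x y - va_mul V y x).
Proof.
move=> [w ->]; rewrite va_comm; apply: big_ind => [|u v|n _].
- exact: iter_image0.
- exact: iter_imageD.
(* The term of index n carries T^(n+1): for n >= k this already factors through T^(k+1), and for n <
   k the n-product is zero. *)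
apply: iter_imageZ; have [nk|kn] := ltnP n k; last exact: iter_image_leq.
by rewrite nprod_iterT_eq0 // iter_linear0; apply: iter_image0.
Qed.

Lemma commutator_iter_image_eq0 k (x y : V) :
    iter_image T k x -> (locality x y <= k)%N ->
  va_mul V x y - va_mul V y x = 0.
Proof.
move=> [w xE] xyk; rewrite va_comm; apply: big1 => n _.
suff -> : lca_nprod V n x y = 0 by rewrite iter_linear0 scaler0.
(* The ranges n < k and n >= [locality x y] cover all n because the locality is at most k. *)
have [nk|kn] := ltnP n k; first by rewrite xE nprod_iterT_eq0.
exact/nprod_locality_eq0/(leq_trans xyk).
Qed.

Variables (A : leftSymAlgebra K) (f : {linear A -> Psi V}).
Hypothesis f_morph : lsa_morphism f.

(** The factors are swapped because [lower_central] keeps its deeper element on the right of the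
    bracket, while the commutator lemmas want the element of T^k V on the left. *)
Lemma morph_commutator (a b : A) :
  f (lsa_commutator a b) = - (va_mul V (f b) (f a) - va_mul V (f a) (f b)).
Proof. by rewrite opprB linearB /= !f_morph. Qed.

Lemma lower_central_iter_image k (a : A) :
  lower_central (lsa_lie A) k a -> iter_image T k (f a).
Proof.
elim: k a => [|k IHk] a; first by exists (f a).
move=> [n [c [s [sP ->]]]]; rewrite linear_sum.
apply: big_ind => [|u v|i _]; [exact: iter_image0|exact: iter_imageD|].
rewrite linearZ; apply: iter_imageZ.
have [x [y [yk ->]]] := sP i.
rewrite [f _]morph_commutator -scaleN1r; apply/iter_imageZ.
exact/iter_image_commutator/IHk.
Qed.

End Commutators.

Theorem proposition3 (K : fieldType) (charK0 : [pchar K] =i pred0)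
    (A : leftSymAlgebra K) (V : vertexAlgebra K)
    (f : {linear A -> Psi V}) (f_morph : lsa_morphism f) (f_inj : injective f)
    (f_local : exists N : nat, forall a b : A,
       (locality (f a : V) (f b : V) <= N)%N) :
  lie_nilpotent (lsa_lie A).
Proof.
(* The term of index N maps into T^N V, so its brackets with [A] vanish; these span the term of
   index [N.+1]. *)
have [N fN] := f_local; exists N.+1; apply/seteqP; split=> a /=; last first.
  by move=> ->; exists 0%N, (fun=> 0), (fun=> 0); split=> [[]|] //; rewrite big_ord0.
move=> [n [c [s [sP ->]]]]; apply: big1 => i _.
have [x [y [yN ->]]] := sP i.
suff -> : lie_br (lsa_lie A) x y = 0 by rewrite scaler0.
apply: f_inj; rewrite [LHS]morph_commutator // linear0.
rewrite (commutator_iter_image_eq0 charK0 (k := N)) ?oppr0 //.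
exact: lower_central_iter_image.
Qed.
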